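(* Let $r<w$ be positive reals. Every deterministic online algorithm (with no restriction on memory) for the $(n,r,w)$-Parity Number of Equality Hats problem is (no better than) $(w/r)$-competitive: there is a feasible input on which the cost of its output is $w$.
   Context: An online algorithm must produce its answer $y_i$ to request $x_i$ from $x_1,\dots,x_i$ (and earlier answers) only; it is $c$-competitive if there is $\alpha\ge 0$ with $cost(A(I))\le c\cdot cost(Opt(I))+\alpha$ for all inputs $I$, $Opt$ an optimal offline algorithm. For $X=(x_1,\dots,x_m)\in\{0,1\}^m$, $EQ_m(X)=1$ if $(x_1,\dots,x_{\lfloor m/2\rfloor})=(x_{\lfloor m/2\rfloor+1},\dots,x_m)$ and $0$ otherwise. The $(n,r,w)$-Parity Number of Equality Hats problem: feasible inputs are $I=(2,X_1,2,X_2,2,X_3)$ of length $n=m_1+m_2+m_3+3$ with $m_i>1$ and $X_i\in\{0,1\}^{m_i}$. Let $y_1,y_2,y_3$ be the output bits at the three requests with value $2$ and $z_j=\bigoplus_{i=j}^{3}EQ_{m_i}(X_i)$. The cost is $r$ if $y_j=z_j$ for all $j$, and $w$ otherwise, with $r<w$.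
   Formalization: ''No better than (w/r)-competitive'' is proved with additive constant α = 0, since with free α ≥ 0 the choice α = w − r makes every algorithm 1-competitive; n ≥ 9 is assumed so that a feasible input exists. *)

(* Defs.v *)
From mathcomp Require Import all_boot all_order all_algebra.
From mathcomp Require Import reals.

Set Implicit Arguments.
Unset Strict Implicit.
Unset Printing Implicit Defensive.

Import Order.TTheory GRing.Theory Num.Theory.
Local Open Scope ring_scope.

(* [A xs ys] is the answer to the last request of [xs], where [xs] is the
   sequence of all requests received so far, the current one included, and
   [ys] is the sequence of all earlier answers. *)
Definition online_algorithm (Req Ans : Type) := seq Req -> seq Ans -> Ans.

Fixpoint answers_from (Req Ans : Type) (A : online_algorithm Req Ans)
    (past : seq Req) (ys : seq Ans) (I : seq Req) : seq Ans :=
  if I is x :: I' then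
    answers_from A (rcons past x) (rcons ys (A (rcons past x) ys)) I'
  else ys.

Definition answers (Req Ans : Type) (A : online_algorithm Req Ans)
    (I : seq Req) : seq Ans := answers_from A [::] [::] I.

(* If [size X] is odd, the two parts have different lengths, so [EQ X] is
   [false]. *)
Definition EQ (X : seq bool) : bool :=
  take (size X)./2 X == drop (size X)./2 X.

(* An input (2, X_1, 2, X_2, 2, X_3) is represented by its three blocks, which
   it determines uniquely because 2 does not occur in a block; [requests X] is
   the sequence of requests itself. Blocks are numbered from 0. *)
Definition hats_input := 3.-tuple (seq bool).

Definition requests (X : hats_input) : seq nat :=
  flatten [seq 2%N :: [seq nat_of_bool b | b <- Xi] | Xi <- X].

Definition feasible (n : nat) (X : hats_input) : Prop :=
  (forall i : 'I_3, (1 < size (tnth X i))%N) /\ size (requests X) = n.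

Definition hat_parity (X : hats_input) (j : 'I_3) : bool :=
  \big[addb/false]_(i < 3 | (j <= i)%N) EQ (tnth X i).

Definition hat_answers (X : hats_input) (ys : seq bool) : seq bool :=
  mask [seq x == 2%N | x <- requests X] ys.

Definition cost (R : realType) (r w : R) (X : hats_input) (ys : seq bool) : R :=
  if hat_answers X ys == [seq hat_parity X j | j <- enum 'I_3] then r else w.

Definition optimal (R : realType) (r w : R) (X : hats_input) (ys : seq bool) :
    Prop :=
  size ys = size (requests X) /\
  forall ys' : seq bool, size ys' = size (requests X) ->
    cost r w X ys <= cost r w X ys'.

Definition competitive_with (n : nat) (R : realType) (r w : R)
    (A : online_algorithm nat bool) (c alpha : R) : Prop :=
  forall X : hats_input, feasible n X ->
  forall opt : seq bool, optimal r w X opt ->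
    cost r w X (answers A (requests X)) <= c * cost r w X opt + alpha.

Definition competitive (n : nat) (R : realType) (r w : R)
    (A : online_algorithm nat bool) (c : R) : Prop :=
  exists alpha : R, 0 <= alpha /\ competitive_with n r w A c alpha.

(* Costs never exceed [w], so with a free additive constant every algorithm
   would be 1-competitive; lower bounds on the competitive ratio are therefore
   meaningful only for the additive constant 0. *)
Definition strictly_competitive (n : nat) (R : realType) (r w : R)
    (A : online_algorithm nat bool) (c : R) : Prop :=
  competitive_with n r w A c 0.

(* Main.v *)
(** The answer to the first request depends on nothing but that request, whereas
    flipping one bit of the two-bit block X_1 flips EQ(X_1) and hence z_1. So
    one of the two inputs makes the first answer wrong. *)

Require Import Defs.
From mathcomp Require Import all_boot all_order all_algebra.
From mathcomp Require Import reals.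

Set Implicit Arguments.
Unset Strict Implicit.
Unset Printing Implicit Defensive.

Import Order.TTheory GRing.Theory Num.Theory.
Local Open Scope ring_scope.

(** The accumulator only grows at its right end, so later requests never revise an answer. This is
    what pins the first answer whatever follows. *)
Lemma answers_from_cat (Req Ans : Type) (A : online_algorithm Req Ans)
    (past : seq Req) (ys : seq Ans) (I : seq Req) :
  exists zs, answers_from A past ys I = ys ++ zs.
Proof.
elim: I past ys => [|x I IH] past ys /=; first by exists [::]; rewrite cats0.
have [zs ->] := IH (rcons past x) (rcons ys (A (rcons past x) ys)).
by rewrite cat_rcons; eexists.
Qed.

(** Lets an offline output show any prescribed bits at the requests with value 2; [x0] fills the
    positions that the mask discards. *)
Lemma mask_surj (T : Type) (x0 : T) (m : bitseq) (t : seq T) :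
  count id m = size t -> exists2 s, size s = size m & mask m s = t.
Proof.
elim: m t => [|[] m IH] [|x t] //=; first by exists [::].
- by case=> /IH[s <- <-]; exists (x :: s).
- by move=> /(IH [::])[s <- <-]; exists (x0 :: s).
- by move=> /(IH (x :: t))[s <- <-]; exists (x0 :: s).
Qed.

Lemma count_requests (X : hats_input) :
  count id [seq x == 2%N | x <- requests X] = 3%N.
Proof.
rewrite count_map /requests -[RHS](size_tuple X).
elim: (tval X) => //= Xi s IH; rewrite count_cat IH.
suff -> : count (preim (eq_op^~ 2%N) id) [seq nat_of_bool b | b <- Xi] = 0%N by [].
by elim: Xi => //= -[] Xi.
Qed.

Lemma feasible_with_parity (n : nat) (b : bool) : (9 <= n)%N ->
  exists2 X : hats_input, feasible n X & hat_parity X ord0 = b.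
Proof.
move=> hn; pose Z := nseq (n - 7) false.
(* The three separators and the two short blocks take 7 requests, and [9 <= n] leaves at least 2 for
   [Z]. The blocks contribute [~~ (b (+) EQ Z)], [true] and [EQ Z], whose sum is [b]. *)
exists [tuple [:: false; b (+) EQ Z]; [:: false; false]; Z].
  split.
    case=> -[|[|[|//]]] ltj; rewrite (tnth_nth [::]) //=.
    by rewrite size_nseq ltn_subRL.
  rewrite /requests /= cats0 size_map size_nseq.
  by rewrite -[RHS](subnKC (ltnW (ltnW hn))).
rewrite /hat_parity big_mkcond !big_ord_recl big_ord0 /= !(tnth_nth [::]) /=.
rewrite addbF {1 2}/EQ /= !eqseq_cons !andbT -/(EQ Z).
by case: b; case: (EQ Z).
Qed.

Section Cost.

Variables (R : realType) (r w : R).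
Hypothesis hrw : r < w.

Lemma cost_ge (X : hats_input) (ys : seq bool) : r <= cost r w X ys.
Proof. by rewrite /cost; case: ifP => // _; exact: ltW. Qed.

Lemma cost_le (X : hats_input) (ys : seq bool) : cost r w X ys <= w.
Proof. by rewrite /cost; case: ifP => // _; exact: ltW. Qed.

(** Offline, all three parities are known and can be written at the separators; this attains the
    lower bound [r]. *)
Lemma optimal_cost (X : hats_input) :
  exists2 opt, optimal r w X opt & cost r w X opt = r.
Proof.
have [|opt sz_opt opt_ok] := @mask_surj bool false
    [seq x == 2%N | x <- requests X] [seq hat_parity X j | j <- enum 'I_3].
  by rewrite count_requests size_map size_enum_ord.
have cost_opt : cost r w X opt = r by rewrite /cost /hat_answers opt_ok eqxx.
exists opt => //; split=> [|ys' _]; first by rewrite sz_opt size_map.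
by rewrite cost_opt cost_ge.
Qed.

Lemma exists_costly_input (n : nat) (A : online_algorithm nat bool) :
  (9 <= n)%N -> exists X : hats_input,
    feasible n X /\ cost r w X (answers A (requests X)) = w.
Proof.
move=> hn.
(* Every input opens with 2, so this first answer is known before [X] is chosen. *)
have [X feasX parX] := feasible_with_parity (~~ A [:: 2%N] [::]) hn.
exists X; split=> //; rewrite /cost ifN // /hat_answers.
have [I ->] : exists I, requests X = 2%N :: I.
  by case: X {feasX parX} => -[|X1 s] //= ?; eexists; rewrite /requests.
have [zs] := answers_from_cat A [:: 2%N] [:: A [:: 2%N] [::]] I.
(* The mask keeps the first answer, so the comparison already fails at the head. *)
rewrite /answers /= => ->; rewrite enum_ordSl /= eqseq_cons parX.
by case: (A _ _).
Qed.

End Cost.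

Theorem theorem7 (R : realType) (r w : R) (n : nat)
    (A : online_algorithm nat bool)
    (hr : 0 < r) (hrw : r < w) (hn : (9 <= n)%N) :
  [/\ exists X : hats_input,
        feasible n X /\ cost r w X (answers A (requests X)) = w,
      competitive n r w A (w / r)
    & forall c : R, strictly_competitive n r w A c -> w / r <= c].
Proof.
have [X [feasX costX]] := exists_costly_input r w A hn.
have w_gt0 : 0 < w := lt_trans hr hrw.
split; first by exists X.
  (* No additive constant is needed: any cost is at most [w = (w / r) * r], and the optimum costs at
     least [r]. *)
  exists 0; split=> // Y _ opt _; rewrite addr0.
  apply: le_trans (cost_le hrw _ _) _.
  rewrite mulrAC ler_pdivlMr // ler_pM2l //.
  exact: cost_ge.
(* On the costly input the bound reads [w <= c * r]. *)
move=> c /(_ X feasX); have [opt opt_min cost_opt] := optimal_cost hrw X.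
by move=> /(_ opt opt_min); rewrite costX cost_opt addr0 ler_pdivrMr.
Qed.
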